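(* Let $(E,\kappa)$ and $(B,\lambda)$ be connected digital images and let $p:(E,\kappa)\to(B,\lambda)$ be a $(\kappa,\lambda)$-continuous surjection. If $p$ has the unique path lifting property and $p$ has no conciliator point, then $p$ is a digital $(\kappa,\lambda)$-covering map.
   Context: A digital image $(X,\kappa)$ is a set $X\subseteq\mathbb{Z}^n$ (for some $n$) with an adjacency relation $\kappa$ (a symmetric, irreflexive relation) on its points; write $x\stackrel{\kappa}{\leftrightarrow}y$ if $x,y$ are $\kappa$-adjacent (so $x\neq y$). $X$ is connected if any two distinct points are joined by a finite sequence of points of $X$ with consecutive ones $\kappa$-adjacent. A function $f:(X,\kappa)\to(Y,\lambda)$ is $(\kappa,\lambda)$-continuous if $x\stackrel{\kappa}{\leftrightarrow}x'$ implies $f(x)=f(x')$ or $f(x)\stackrel{\lambda}{\leftrightarrow}f(x')$. It is a $(\kappa,\lambda)$-isomorphism if it is a continuous bijection with $(\lambda,\kappa)$-continuous inverse (subsets carry the restricted adjacency). $[a,b]_{\mathbb{Z}}=\{z\in\mathbb{Z}: a\le z\le b\}$ for integers $a<b$, with adjacency given by $|z-z'|=1$. A digital $\kappa$-path in $X$ is a continuous map $[0,m]_{\mathbb{Z}}\to X$. $N_\kappa(x,1)$ is the set consisting of $x$ and all points of $X$ that are $\kappa$-adjacent to $x$. Let $p:(E,\kappa)\to(B,\lambda)$ be a $(\kappa,\lambda)$-continuous surjection. A lifting of a path $\alpha:[0,m]_{\mathbb{Z}}\to B$ is a $\kappa$-path $\widetilde\alpha:[0,m]_{\mathbb{Z}}\to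 E$ with $p\circ\widetilde\alpha=\alpha$. The map $p$ has the unique path lifting property if both: (path lifting) for every digital path $\alpha$ in $B$ and every $e\in p^{-1}(\alpha(0))$ there is a lifting $\widetilde\alpha$ of $\alpha$ with $\widetilde\alpha(0)=e$; and (uniqueness of path lifts) any two paths $\alpha,\beta:[0,m]_{\mathbb{Z}}\to E$ with $p\circ\alpha=p\circ\beta$ and $\alpha(0)=\beta(0)$ are equal. A point $e\in E$ is a conciliator point for $p$ if there exist $e',e''\in N_\kappa(e,1)$ such that $e'$ and $e''$ are not $\kappa$-adjacent but $p(e')\stackrel{\lambda}{\leftrightarrow}p(e'')$. The $(\kappa,\lambda)$-continuous surjection $p$ is a digital $(\kappa,\lambda)$-covering map if for each $b\in B$ there is an index set $M$ and points $e_i\in p^{-1}(b)$ ($i\in M$) such that: (1) $p^{-1}(N_\lambda(b,1))=\bigcup_{i\in M}N_\kappa(e_i,1)$; (2) $N_\kappa(e_i,1)\cap N_\kappa(e_j,1)=\emptyset$ for $i\neq j$ in $M$; (3) for every $i\in M$ the restriction $p|_{N_\kappa(e_i,1)}:N_\kappa(e_i,1)\to N_\lambda(b,1)$ is a $(\kappa,\lambda)$-isomorphism. *)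

(* Defs.v *)
From mathcomp Require Import all_boot all_order all_algebra.
From mathcomp Require Import all_classical.

Set Implicit Arguments.
Unset Strict Implicit.
Unset Printing Implicit Defensive.

Local Open Scope classical_set_scope.

(* A set of lattice points with an arbitrary symmetric irreflexive relation on
   it; [adj] relates points of the image only, via [set_type]. *)
Record digital_image := DigitalImage {
  dim : nat;
  support : set 'rV[int]_dim;
  adj : support -> support -> Prop;
  adj_sym : forall x y, adj x y -> adj y x;
  adj_irr : forall x, ~ adj x x
}.

Definition points (X : digital_image) : Type := set_type (@support X).
Coercion points : digital_image >-> Sortclass.

Arguments adj {X} x y : rename.

Definition connected_image (X : digital_image) : Prop :=
  forall x y : X, x <> y ->
    exists (m : nat) (c : nat -> X),
      [/\ c 0 = x, c m = y & forall i, i < m -> adj (c i) (c i.+1)].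

Definition continuous_for (S T : Type) (k : S -> S -> Prop) (l : T -> T -> Prop)
    (f : S -> T) : Prop :=
  forall x x', k x x' -> f x = f x' \/ l (f x) (f x').

Definition isomorphism_for (S T : Type) (k : S -> S -> Prop)
    (l : T -> T -> Prop) (f : S -> T) : Prop :=
  continuous_for k l f /\
  exists g : T -> S, [/\ cancel f g, cancel g f & continuous_for l k g].

Definition restr (S : Type) (k : S -> S -> Prop) (A : set S) : A -> A -> Prop :=
  fun x y => k (val x) (val y).

(* [f] maps [A] into [B], and the induced function [h : A -> B] is an
   isomorphism for the restricted adjacencies. *)
Definition restricts_to_isomorphism (S T : Type) (k : S -> S -> Prop)
    (l : T -> T -> Prop) (A : set S) (B : set T) (f : S -> T) : Prop :=
  exists h : A -> B,
    (forall x : A, val (h x) = f (val x)) /\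
    isomorphism_for (restr k (A:=A)) (restr l (A:=B)) h.

(* The interval [0,m] of integers is encoded by ['I_m.+1]. *)
Definition interval_adj (m : nat) (i j : 'I_m.+1) : Prop :=
  (`|i%:Z - j%:Z| = 1)%R.

Definition digital_path (X : digital_image) (m : nat) (a : 'I_m.+1 -> X) : Prop :=
  continuous_for (@interval_adj m) (@adj X) a.

(* The closed neighbourhood N(x,1). *)
Definition nbhd1 (X : digital_image) (x : X) : set X :=
  [set y | y = x \/ adj x y].

Section Maps.
Variables (E B : digital_image) (p : E -> B).

Definition continuous_surjection : Prop :=
  continuous_for (@adj E) (@adj B) p /\ (forall b : B, exists e : E, p e = b).

(* Intervals are nondegenerate, hence [0 < m]. *)
Definition path_lifting : Prop :=
  forall (m : nat) (a : 'I_m.+1 -> B), 0 < m -> digital_path a ->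
  forall e : E, p e = a ord0 ->
    exists a' : 'I_m.+1 -> E,
      [/\ digital_path a', forall i, p (a' i) = a i & a' ord0 = e].

Definition unique_path_lifts : Prop :=
  forall (m : nat) (a b : 'I_m.+1 -> E), 0 < m ->
    digital_path a -> digital_path b ->
    (forall i, p (a i) = p (b i)) -> a ord0 = b ord0 -> a =1 b.

Definition unique_path_lifting_property : Prop :=
  path_lifting /\ unique_path_lifts.

Definition conciliator_point (e : E) : Prop :=
  exists e' e'' : E,
    [/\ nbhd1 e e', nbhd1 e e'', ~ adj e' e'' & adj (p e') (p e'')].

Definition digital_covering_map : Prop :=
  continuous_surjection /\
  forall b : B, exists (M : Type) (s : M -> E),
    [/\ forall i, p (s i) = b,
        p @^-1` nbhd1 b = \bigcup_(i in [set: M]) nbhd1 (s i),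
        forall i j, i <> j -> nbhd1 (s i) `&` nbhd1 (s j) = set0
      & forall i, restricts_to_isomorphism (@adj E) (@adj B)
                    (nbhd1 (s i)) (nbhd1 b) p].

End Maps.

(* Main.v *)
Require Import Defs.
From mathcomp Require Import all_boot.
From mathcomp Require Import all_classical.

Set Implicit Arguments.
Unset Strict Implicit.
Unset Printing Implicit Defensive.

Local Open Scope classical_set_scope.

(** Unique path lifting is only ever needed for paths with a single step.
    For such paths it says that [p] maps each closed neighbourhood [N(e,1)]
    bijectively onto [N(p e,1)]: a step from [p e] to a point of [N(p e,1)]
    lifts to a step from [e] ([nbhd1_lift]), and two steps from [e] with the
    same image agree ([nbhd1_inj]).

    Hence the whole fibre over [b] can serve as the index set.  The
    neighbourhoods of its points cover the preimage of [N(b,1)], since from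
    any [x] above [N(b,1)] the step from [p x] to [b] lifts to a step reaching
    the fibre.  They are pairwise disjoint, since a common point [x] of [N(e,1)]
    and [N(e',1)] would have [e] and [e'] in its own neighbourhood, where [p] is
    injective.  Finally the bijection from [N(e,1)] to [N(b,1)] preserves
    adjacency, because a step contracted by [p] would contradict uniqueness
    ([adj_image]), and its inverse is continuous because [e] is not a
    conciliator point. *)

Section DigitalImage.
Variable X : digital_image.
Implicit Types x y : X.

Lemma nbhd1_refl x : nbhd1 x x.
Proof. by left. Qed.

Lemma nbhd1_sym x y : nbhd1 x y -> nbhd1 y x.
Proof. by case=> [->|xy]; [left | right; exact: adj_sym]. Qed.

Definition step_path x y (i : 'I_2) : X := if i == ord0 then x else y.

Lemma step_path_digital x y : nbhd1 x y -> digital_path (step_path x y).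
Proof.
move=> xy i j _; rewrite /step_path.
case: (i == ord0); case: (j == ord0); try by left.
- by case: xy => [->|]; [left | right].
- by case: (nbhd1_sym xy) => [->|]; [left | right].
Qed.

Lemma digital_path_step (a : 'I_2 -> X) :
  digital_path a -> nbhd1 (a ord0) (a ord_max).
Proof.
move=> /(_ ord0 ord_max erefl) [->|a01]; first exact: nbhd1_refl.
by right.
Qed.

End DigitalImage.

Section LocalBijectivity.
Variables (E B : digital_image) (p : E -> B).

(** The path may be constant, so [b = p e] needs no separate treatment. *)
Lemma nbhd1_lift (e : E) (b : B) : path_lifting p ->
  nbhd1 (p e) b -> exists2 x, nbhd1 e x & p x = b.
Proof.
move=> lift /step_path_digital peb.
have [a [a_path pa <-]] := lift 1 _ isT peb e erefl.
by exists (a ord_max); [exact: digital_path_step | rewrite pa].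
Qed.

Lemma nbhd1_inj (e x y : E) : unique_path_lifts p ->
  nbhd1 e x -> nbhd1 e y -> p x = p y -> x = y.
Proof.
move=> uniq /step_path_digital ex /step_path_digital ey pxy.
have step_eq : forall i, p (step_path e x i) = p (step_path e y i).
  by move=> i; rewrite /step_path; case: ifP.
exact: (uniq 1 _ _ isT ex ey step_eq erefl ord_max).
Qed.

(** A continuous map may contract an edge to a point; uniqueness of lifts
    excludes this, as the contracted step and the constant path would be two
    lifts of the same constant path. *)
Lemma adj_image (x y : E) : continuous_for (@adj E) (@adj B) p ->
  unique_path_lifts p -> adj x y -> adj (p x) (p y).
Proof.
move=> p_cont uniq xy; case: (p_cont _ _ xy) => // pxy.
have eq_xy : x = y.
  by apply: (@nbhd1_inj x) => //; [exact: nbhd1_refl | right].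
by rewrite eq_xy in xy; case: (adj_irr xy).
Qed.

Lemma nbhd1_image (x y : E) : continuous_for (@adj E) (@adj B) p ->
  nbhd1 x y -> nbhd1 (p x) (p y).
Proof.
move=> p_cont [->|/p_cont [->|]]; [exact: nbhd1_refl | exact: nbhd1_refl |].
by right.
Qed.

(** Unique path lifting alone makes [p] a bijection from [N(e,1)] to
    [N(p e,1)].  Two nonadjacent points of [N(e,1)] with adjacent images are
    the only obstruction to continuity of the inverse, and such a pair is what
    makes [e] a conciliator point. *)
Lemma nbhd1_isomorphism (e : E) : continuous_for (@adj E) (@adj B) p ->
  unique_path_lifting_property p -> ~ conciliator_point p e ->
  restricts_to_isomorphism (@adj E) (@adj B) (nbhd1 e) (nbhd1 (p e)) p.
Proof.
move=> p_cont [lift uniq] nocon.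
have h_in (x : nbhd1 e) : p (val x) \in nbhd1 (p e).
  by apply/mem_set/nbhd1_image => //; exact/set_mem/valP.
pose h (x : nbhd1 e) : nbhd1 (p e) := SigSub (h_in x).
have /choice [g gK] : forall y : nbhd1 (p e), exists x : nbhd1 e, h x = y.
  move=> y; have [x ex px] := nbhd1_lift lift (set_mem (valP y)).
  by exists (SigSub (mem_set ex)); apply: val_inj.
exists h; split=> //; split.
  by move=> x y xy; right; exact: adj_image.
exists g; split=> //.
  move=> x; apply: val_inj; apply: (@nbhd1_inj e) => //.
  - exact/set_mem/valP.
  - exact/set_mem/valP.
  - exact: (congr1 val (gK (h x))).
move=> x y xy; right; apply: contrapT => not_adj; apply: nocon.
exists (val (g x)), (val (g y)); split=> //.
- exact/set_mem/valP.
- exact/set_mem/valP.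
- by rewrite -(gK x) -(gK y) in xy.
Qed.

End LocalBijectivity.

Theorem theorem3p8 (E B : digital_image) (p : E -> B)
    (E_connected : connected_image E) (B_connected : connected_image B)
    (p_surj : continuous_surjection p)
    (p_upl : unique_path_lifting_property p)
    (p_nocon : ~ (exists e : E, conciliator_point p e)) :
  digital_covering_map p.
Proof.
split=> // b; have [p_cont _] := p_surj; have [lift uniq] := p_upl.
pose M : Type := set_type [set e : E | p e = b].
have fibre (i : M) : p (val i) = b by exact: (set_mem (valP i)).
exists M, val; split=> //.
- apply/seteqP; split=> [x /nbhd1_sym bx | x [i _ ix]].
    have [e xe pe] := nbhd1_lift lift bx.
    have e_fibre : e \in [set e : E | p e = b] by exact: mem_set.
    by exists (SigSub e_fibre) => //; exact: nbhd1_sym.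
  by rewrite /preimage /= -(fibre i); exact: nbhd1_image.
- move=> i j ij; apply/seteqP; split=> // x [/nbhd1_sym xi /nbhd1_sym xj].
  apply: ij; apply: val_inj; apply: (@nbhd1_inj _ _ p x) => //.
  by rewrite !fibre.
- move=> i; move: (val i) (fibre i) => e <-.
  by apply: nbhd1_isomorphism => // con; apply: p_nocon; exists e.
Qed.
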